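(* Let $k\ge2$ and $\nu_{k-1}\in\ell^1$ (so $(S^T)^{k-1}\nu_{k-1}\in L^1_{-k+1}$). The smooth map $$\mathcal J_{\nu_{k-1}}:\ell^\infty\times\ell^1\to I^1_{-,0,k-1},\qquad \mathcal J_{\nu_{k-1}}(\mathbf q,\mathbf p)=\mathbf p+(S^T)^{k-1}\nu_{k-1}e^{s^{k-1}(\mathbf q)-\mathbf q},$$ is constant on the $\boldsymbol\sigma^{\nu_{k-1}}$-orbits of the subgroup $GL_0^{\infty,k-1}$. In addition: (i) $\mathcal J_{\nu_{k-1}}$ is a momentum map. More precisely, for all $f,g\in C^\infty(I^1_{-,0,k-1})$, $$\{f\circ\mathcal J_{\nu_{k-1}},g\circ\mathcal J_{\nu_{k-1}}\}_\omega=\{f,g\}_{0,k-1}\circ\mathcal J_{\nu_{k-1}},$$ where $\{\cdot,\cdot\}_\omega$ is the canonical Poisson bracket of the weak symplectic Banach space $(\ell^\infty\times\ell^1,\omega)$ and $\{\cdot,\cdot\}_{0,k-1}$ is the Lie-Poisson bracket on $I^1_{-,0,k-1}$. (ii) $\mathcal J_{\nu_{k-1}}$ is $GI^\infty_{+,0,k-1}$-equivariant, that is, $\mathcal J_{\nu_{k-1}}\circ\boldsymbol\sigma_g^{\nu_{k-1}}=(\operatorname{Ad}^{+,k})^*_{g^{-1}}\circ\mathcal J_{\nu_{k-1}}$ for any $g\in GI^\infty_{+,0,k-1}$. (iii) One has $\mathcal J_{\nu_{k-1}}(\ell^\infty\times\ell^1)=(\delta^k)^{-1}(\Delta_{\nu_{k-1}})$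 and $\mathcal J_{\nu_{k-1}}(\ell^\infty\times\{0\})=\Delta_{\nu_{k-1}}$. Hence, if $\nu_{k-1}$ is generic (all its entries are nonzero), $\mathcal J_{\nu_{k-1}}$ induces an identification $(\ell^\infty\times\ell^1)/\boldsymbol\sigma^{\nu_{k-1}}(GL_0^{\infty,k-1})\cong\mathcal J_{\nu_{k-1}}(\ell^\infty\times\ell^1)$, and $\mathcal J_{\nu_{k-1}}(\ell^\infty\times\ell^1)$ consists of those coadjoint orbits of $GI^\infty_{+,0,k-1}$ in $I^1_{-,0,k-1}$ which are projected by $\delta^k$ to the $\alpha^k$-orbit $\Delta_{\nu_{k-1}}$.
   Context: Let $\mathcal H$ be a real separable Hilbert space with orthonormal basis $\{|n\rangle\}_{n\ge0}$. Sequences in $\ell^\infty$ (resp. $\ell^1$) are identified with bounded (resp. trace class) diagonal operators; products, exponentials and logarithms are componentwise. $S=\sum_{n\ge0}|n\rangle\langle n+1|$, $S^T$ its adjoint. For a diagonal operator $x=(x_0,x_1,\dots)$: $s(x)=(x_1,x_2,\dots)$, $\tilde s(x)=(0,x_0,x_1,\dots)$. $GI^\infty_{+,0,k-1}$ is the Banach Lie group of elements $g=g_0+g_{k-1}S^{k-1}$, $g_0,g_{k-1}\in\ell^\infty$, with entries of $g_0$ bounded below by a strictly positive number (depending on $g_0$), with product $g\circ_kh=g_0h_0+(g_0h_{k-1}+g_{k-1}s^{k-1}(h_0))S^{k-1}$. $GL_0^{\infty,k-1}$ is its subgroup of diagonal elements $g_0$ with $s^{k-1}(g_0)=g_0$.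 Its Lie algebra is $I^\infty_{+,0,k-1}=\{x_0+x_{k-1}S^{k-1}\mid x_0,x_{k-1}\in\ell^\infty\}$ with bracket $[x,y]_k=\big(x_{k-1}(s^{k-1}(y_0)-y_0)-y_{k-1}(s^{k-1}(x_0)-x_0)\big)S^{k-1}$, and predual $I^1_{-,0,k-1}=\{\rho_0+(S^T)^{k-1}\rho_{k-1}\mid\rho_0,\rho_{k-1}\in\ell^1\}$, paired by $\operatorname{Tr}(\rho x)=\operatorname{Tr}(\rho_0x_0)+\operatorname{Tr}(\rho_{k-1}x_{k-1})$. The Lie-Poisson bracket is $\{f,h\}_{0,k-1}(\rho)=\operatorname{Tr}(\rho[Df(\rho),Dh(\rho)]_k)$. The coadjoint action is $$(\operatorname{Ad}^{+,k})^*_{g^{-1}}\rho=\rho_0+g_0^{-1}g_{k-1}\rho_{k-1}-\tilde s^{k-1}(g_0^{-1}g_{k-1}\rho_{k-1})+(S^T)^{k-1}s^{k-1}(g_0)g_0^{-1}\rho_{k-1}.$$ $L^1_{-k+1}=\{(S^T)^{k-1}\rho_{k-1}\mid\rho_{k-1}\in\ell^1\}$, and $\delta^k:I^1_{-,0,k-1}\to L^1_{-k+1}$, $\rho_0+(S^T)^{k-1}\rho_{k-1}\mapsto(S^T)^{k-1}\rho_{k-1}$. The $\alpha^k$-action of $GI^\infty_{+,0,k-1}$ on $L^1_{-k+1}$ is $\alpha^k_g((S^T)^{k-1}\rho_{k-1})=(S^T)^{k-1}s^{k-1}(g_0)g_0^{-1}\rho_{k-1}$, and $\Delta_{\nu_{k-1}}$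 is the $\alpha^k$-orbit of $(S^T)^{k-1}\nu_{k-1}$. The action $\boldsymbol\sigma^{\nu_{k-1}}$ of $GI^\infty_{+,0,k-1}$ on $\ell^\infty\times\ell^1$ is $$\boldsymbol\sigma_g^{\nu_{k-1}}(\mathbf q,\mathbf p)=\Big(\mathbf q+\log g_0,\ \mathbf p+g_{k-1}g_0^{-1}\nu_{k-1}e^{s^{k-1}(\mathbf q)-\mathbf q}-\tilde s^{k-1}\big(g_{k-1}g_0^{-1}\nu_{k-1}e^{s^{k-1}(\mathbf q)-\mathbf q}\big)\Big).$$ $\ell^\infty\times\ell^1$ has the weak symplectic form $\omega((\mathbf q,\mathbf p),(\mathbf q',\mathbf p'))=\langle\mathbf q,\mathbf p'\rangle-\langle\mathbf q',\mathbf p\rangle$, $\langle\mathbf q,\mathbf p\rangle=\sum_iq_ip_i$. A smooth function $f$ has a Hamiltonian vector field ($\mathbf df=\omega(X_f,\cdot)$) iff $\partial f/\partial\mathbf q\in\ell^1\subset(\ell^\infty)^*$ at every point; $C^\infty_\omega$ denotes the set of these functions, on which $\{f,g\}_\omega=\omega(X_f,X_g)=\sum_i\big(\frac{\partial f}{\partial q_i}\frac{\partial g}{\partial p_i}-\frac{\partial g}{\partial q_i}\frac{\partial f}{\partial p_i}\big)$. A smooth map $\mathbf J$ from a weak symplectic manifold to the predual of a Banach Lie algebra is a momentum map if $\{\varphi\circ\mathbf J,\psi\circ\mathbf J\}_\omega=\{\varphi,\psi\}\circ\mathbf J$ for all (locally defined) smooth $\varphi,\psi$ such that $\varphi\circ\mathbf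 J,\psi\circ\mathbf J\in C^\infty_\omega$. *)

(* Defs.v *)
From HB Require Import structures.
From mathcomp Require Import all_boot all_order all_algebra.
From mathcomp Require Import ring lra.
From mathcomp Require Import all_classical all_reals all_analysis.

Set Implicit Arguments.
Unset Strict Implicit.
Unset Printing Implicit Defensive.

Import Order.TTheory GRing.Theory Num.Theory.
Import numFieldNormedType.Exports.

Local Open Scope classical_set_scope.
Local Open Scope ring_scope.

Section Linf.
Context {R : realType}.

Definition linf_pred : pred (nat -> R^o) := [pred f | `[< bounded_fun f >]].

Lemma linf_predP (f : nat -> R^o) :
  reflect (exists M : R, forall n, `|f n| <= M) (f \in linf_pred).
Proof.
have PF : ProperFilter (globally [set: nat]).
  exact: (globally_properfilter (a := 0)).
apply: (iffP idP) => [/asboolP/ex_bound[M fM]|[M fM]].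
  by exists M => n; exact: fM.
by apply/asboolP/ex_bound; exists M => n _; exact: fM.
Qed.

Record linf := Linf { linf_val :> nat -> R^o; linf_valP : linf_val \in linf_pred }.

HB.instance Definition _ := [isSub for linf_val].
HB.instance Definition _ := [Choice of linf by <:].

Fact linf_submod : submod_closed linf_pred.
Proof.
split; first by apply/linf_predP; exists 0 => n; rewrite normr0.
move=> a f g /linf_predP[M fM] /linf_predP[N gN].
apply/linf_predP; exists (`|a| * M + N) => n.
by rewrite (le_trans (ler_normD _ _))// lerD// normrM ler_wpM2l.
Qed.
HB.instance Definition _ := GRing.isSubmodClosed.Build _ _ linf_pred linf_submod.
HB.instance Definition _ := [SubChoice_isSubLmodule of linf by <:].

Lemma linf_eqP (x y : linf) : x =1 y -> x = y.
Proof. by move=> xy; apply/val_inj/funext. Qed.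

Lemma linf_bounded (x : linf) : exists M : R, forall n, `|x n| <= M.
Proof. exact/linf_predP/linf_valP. Qed.

Definition linf_norm (x : linf) : R := sup (range (fun n => `|x n|)).

Lemma linf_norm_ge (x : linf) n : `|x n| <= linf_norm x.
Proof.
apply: sup_upper_bound; last by exists n.
split; first by exists `|x 0|; exists 0.
by have [M xM] := linf_bounded x; exists M => _ [m _ <-].
Qed.

Lemma linf_norm_le (x : linf) M : (forall n, `|x n| <= M) -> linf_norm x <= M.
Proof.
move=> xM; apply: ge_sup; first by exists `|x 0|; exists 0.
by move=> _ [m _ <-].
Qed.

Fact linf_normD (x y : linf) : linf_norm (x + y) <= linf_norm x + linf_norm y.
Proof.
apply: linf_norm_le => n.
by rewrite (le_trans (ler_normD _ _))// lerD// linf_norm_ge.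
Qed.

Fact linf_normZ (a : R) (x : linf) : linf_norm (a *: x) = `|a| * linf_norm x.
Proof.
have leZ (b : R) (y : linf) : linf_norm (b *: y) <= `|b| * linf_norm y.
  by apply: linf_norm_le => n; rewrite normrM ler_wpM2l// linf_norm_ge.
apply/eqP; rewrite eq_le leZ/=.
have [->|a0] := eqVneq a 0.
  by rewrite normr0 mul0r (le_trans _ (linf_norm_ge _ 0)).
rewrite -ler_pdivlMl ?normr_gt0// -normfV.
by rewrite (le_trans _ (leZ _ _))// scalerA mulVf// scale1r.
Qed.

Fact linf_norm_eq0 (x : linf) : linf_norm x = 0 -> x = 0.
Proof.
move=> x0; apply: linf_eqP => n; apply/eqP.
by rewrite -normr_eq0 eq_le normr_ge0 andbT -x0 linf_norm_ge.
Qed.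

HB.instance Definition _ :=
  Lmodule_isNormed.Build R linf linf_normD linf_normZ linf_norm_eq0.

End Linf.
Arguments linf : clear implicits.

Section L1.
Context {R : realType}.

Definition l1_pred : pred (nat -> R^o) :=
  [pred f : nat -> R^o | `[< cvgn [normed series f] >]].

Lemma l1_predP (f : nat -> R^o) :
  reflect (exists M : R, forall n, [normed series f] n <= M) (f \in l1_pred).
Proof.
have nd : nondecreasing_seq [normed series f].
  by apply/nondecreasing_seqP => n; rewrite /= /series/= big_nat_recr//= lerDl.
apply: (iffP idP) => [/asboolP cf|[M fM]].
  by exists (limn [normed series f]) => n; exact: nondecreasing_cvgn_le.
apply/asboolP/nondecreasing_is_cvgn => //.
by exists M => _ [n _ <-].
Qed.

Record l1 := L1 { l1_val :> nat -> R^o; l1_valP : l1_val \in l1_pred }.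

HB.instance Definition _ := [isSub for l1_val].
HB.instance Definition _ := [Choice of l1 by <:].

Fact l1_submod : submod_closed l1_pred.
Proof.
split.
  by apply/l1_predP; exists 0 => n; rewrite /= /series/= big1// => i _; rewrite normr0.
move=> a f g /l1_predP[M fM] /l1_predP[N gN].
apply/l1_predP; exists (`|a| * M + N) => n.
apply: (@le_trans _ _ (`|a| * [normed series f] n + [normed series g] n)).
  rewrite /= /series/= mulr_sumr -big_split/= ler_sum// => i _.
  by rewrite (le_trans (ler_normD _ _))// normrM.
by rewrite lerD// ler_wpM2l.
Qed.
HB.instance Definition _ := GRing.isSubmodClosed.Build _ _ l1_pred l1_submod.
HB.instance Definition _ := [SubChoice_isSubLmodule of l1 by <:].

Lemma l1_eqP (x y : l1) : x =1 y -> x = y.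
Proof. by move=> xy; apply/val_inj/funext. Qed.

Lemma l1_cvg (x : l1) : cvgn [normed series x].
Proof. exact/asboolP/l1_valP. Qed.

Definition l1_norm (x : l1) : R := limn [normed series x].

Lemma l1_norm_ge (x : l1) n : [normed series x] n <= l1_norm x.
Proof.
apply: nondecreasing_cvgn_le; last exact: l1_cvg.
by apply/nondecreasing_seqP => m; rewrite /= /series/= big_nat_recr//= lerDl.
Qed.

Lemma l1_norm_le (x : l1) M : (forall n, [normed series x] n <= M) -> l1_norm x <= M.
Proof. by move=> xM; apply: limr_le; [exact: l1_cvg|exact: nearW]. Qed.

Fact l1_normD (x y : l1) : l1_norm (x + y) <= l1_norm x + l1_norm y.
Proof.
apply: l1_norm_le => n.
rewrite (le_trans _ (lerD (l1_norm_ge x n) (l1_norm_ge y n)))//.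
by rewrite /= /series/= -big_split/= ler_sum// => i _; exact: ler_normD.
Qed.

Fact l1_normZ (a : R) (x : l1) : l1_norm (a *: x) = `|a| * l1_norm x.
Proof.
pose u : nat -> R^o := [normed series x].
have cu : cvgn u by exact: l1_cvg.
rewrite -[RHS]/(`|a| *: limn u) -limZl_tmp// /l1_norm.
congr (limn _); apply/funext => n; rewrite /u /= /series/=.
rewrite -[RHS]/(`|a| * _) mulr_sumr.
by apply: eq_bigr => i _; rewrite -normrM.
Qed.

Fact l1_norm_eq0 (x : l1) : l1_norm x = 0 -> x = 0.
Proof.
move=> x0; apply: l1_eqP => n; apply/eqP.
rewrite -normr_eq0 eq_le normr_ge0 andbT -x0 (le_trans _ (l1_norm_ge _ n.+1))//.
by rewrite /= /series/= big_nat_recr//= lerDr sumr_ge0.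
Qed.

HB.instance Definition _ :=
  Lmodule_isNormed.Build R l1 l1_normD l1_normZ l1_norm_eq0.

End L1.
Arguments l1 : clear implicits.
Arguments l1_cvg {R} x.

Section Operations.
Context {R : realType}.
Implicit Types (x y : linf R) (r : l1 R).

Fact linf_mul_subproof x y : (fun n => x n * y n) \in linf_pred.
Proof.
have [M xM] := linf_bounded x; have [N yN] := linf_bounded y.
by apply/linf_predP; exists (M * N) => n; rewrite normrM ler_pM.
Qed.
Definition linf_mul x y : linf R := Linf (linf_mul_subproof x y).

Fact linf_exp_subproof x : (fun n => expR (x n)) \in linf_pred.
Proof.
have [M xM] := linf_bounded x; apply/linf_predP; exists (expR M) => n.
by rewrite ger0_norm ?expR_ge0// ler_expR (le_trans (ler_norm _)).
Qed.
Definition linf_exp x : linf R := Linf (linf_exp_subproof x).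

Fact linf_shift_subproof x : (fun n => x n.+1) \in linf_pred.
Proof. by have [M xM] := linf_bounded x; apply/linf_predP; exists M => n. Qed.
Definition linf_shift x : linf R := Linf (linf_shift_subproof x).

Fact l1_mul_subproof x r : (fun n => x n * r n) \in l1_pred.
Proof.
have [M xM] := linf_bounded x; apply/l1_predP.
exists (M * l1_norm r) => n; have M0 : 0 <= M by rewrite (le_trans _ (xM 0)).
apply: le_trans (ler_wpM2l M0 (l1_norm_ge r n)).
rewrite /= /series/= mulr_sumr ler_sum// => i _.
by rewrite normrM ler_wpM2r.
Qed.
Definition l1_mul x r : l1 R := L1 (l1_mul_subproof x r).

Fact l1_unshift_subproof r : (fun n => if n is m.+1 then r m else 0) \in l1_pred.
Proof.
apply/l1_predP; exists (l1_norm r) => n; apply: le_trans (l1_norm_ge r n).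
rewrite /= /series/=; case: n => [|n]; first by rewrite !big_geq.
by rewrite big_nat_recl// normr0 add0r big_nat_recr//= lerDl.
Qed.
Definition l1_unshift r : l1 R := L1 (l1_unshift_subproof r).

End Operations.

Declare Scope seq_space_scope.
Delimit Scope seq_space_scope with SS.
Local Open Scope seq_space_scope.
Notation "x ** y" := (linf_mul x y)
  (at level 40, left associativity) : seq_space_scope.
Notation "x *** r" := (l1_mul x r)
  (at level 40, left associativity) : seq_space_scope.
Notation "s^( m ) x" := (iter m linf_shift x)
  (at level 10, x at level 9, format "s^( m )  x") : seq_space_scope.
Notation "st^( m ) r" := (iter m l1_unshift r)
  (at level 10, r at level 9, format "st^( m )  r") : seq_space_scope.

Section ContinuousLinear.
Context {R : realType} {V W : normedModType R}.

Definition clin_pred : pred (V -> W) := [pred f | `[< linear f /\ continuous f >]].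

Record clin := Clin { clin_val :> V -> W; clin_valP : clin_val \in clin_pred }.

HB.instance Definition _ := [isSub for clin_val].
HB.instance Definition _ := [Choice of clin by <:].

Fact clin_submod : submod_closed clin_pred.
Proof.
split.
  apply/asboolP; split; last exact: cst_continuous.
  by move=> a u v; rewrite /= scaler0 addr0.
move=> a f g /asboolP[lf cf] /asboolP[lg cg]; apply/asboolP; split.
  move=> b u v; rewrite -[LHS]/(a *: f (b *: u + v) + g (b *: u + v)).
  rewrite lf lg -[in RHS]/(a *: f u + g u) -[in RHS]/(a *: f v + g v).
  by rewrite !scalerDr !scalerA (mulrC a b) addrACA.
move=> u; apply: cvgD; last exact: cg.
by apply: cvgZl_tmp; exact: cf.
Qed.
HB.instance Definition _ := GRing.isSubmodClosed.Build _ _ clin_pred clin_submod.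
HB.instance Definition _ := [SubChoice_isSubLmodule of clin by <:].

Lemma clin_eqP (f g : clin) : f =1 g -> f = g.
Proof. by move=> fg; apply/val_inj/funext. Qed.

Lemma clin_linear (f : clin) : linear f.
Proof. by have /asboolP[] := clin_valP f. Qed.

Lemma clin_continuous (f : clin) : continuous f.
Proof. by have /asboolP[] := clin_valP f. Qed.

HB.instance Definition _ (f : clin) :=
  GRing.isLinear.Build R V W _ (clin_val f) (clin_linear f).

Definition clin_norm (f : clin) : R :=
  sup [set `|f x| | x in [set x : V | `|x| <= 1]].

Let clin_has_sup (f : clin) : has_sup [set `|f x| | x in [set x : V | `|x| <= 1]].
Proof.
split; first by exists `|f 0|; exists 0 => //=; rewrite normr0.
have /linear_bounded_continuous/bounded_funP/(_ 1)[M fM] := @clin_continuous f.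
by exists M => _ [x /= x1 <-]; exact: fM.
Qed.

Lemma clin_norm_ge1 (f : clin) x : `|x| <= 1 -> `|f x| <= clin_norm f.
Proof. by move=> x1; apply: sup_upper_bound => //; exists x. Qed.

Lemma clin_norm_ge (f : clin) x : `|f x| <= clin_norm f * `|x|.
Proof.
have [->|x0] := eqVneq x 0; first by rewrite linear0 !normr0 mulr0.
rewrite -ler_pdivrMr ?normr_gt0// mulrC -[X in X * _]ger0_norm//.
by rewrite -normrZ -linearZ; apply: clin_norm_ge1; rewrite normfZV.
Qed.

Lemma clin_norm_le (f : clin) (M : R) :
  (forall x, `|x| <= 1 -> `|f x| <= M) -> clin_norm f <= M.
Proof.
move=> fM; apply: ge_sup; first by case: (clin_has_sup f).
by move=> _ [x /= x1 <-]; exact: fM.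
Qed.

Fact clin_normD (f g : clin) : clin_norm (f + g) <= clin_norm f + clin_norm g.
Proof.
apply: clin_norm_le => x x1.
by rewrite (le_trans (ler_normD _ _))// lerD// clin_norm_ge1.
Qed.

Fact clin_normZ (a : R) (f : clin) : clin_norm (a *: f) = `|a| * clin_norm f.
Proof.
have leZ (b : R) (g : clin) : clin_norm (b *: g) <= `|b| * clin_norm g.
  by apply: clin_norm_le => x x1; rewrite normrZ ler_wpM2l// clin_norm_ge1.
apply/eqP; rewrite eq_le leZ/=.
have [->|a0] := eqVneq a 0.
  by rewrite normr0 mul0r (le_trans _ (clin_norm_ge1 _ (x := 0) _)) ?normr0.
rewrite -ler_pdivlMl ?normr_gt0// -normfV.
by rewrite (le_trans _ (leZ _ _))// scalerA mulVf// scale1r.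
Qed.

Fact clin_norm_eq0 (f : clin) : clin_norm f = 0 -> f = 0.
Proof.
move=> f0; apply: clin_eqP => x; apply/eqP.
by rewrite -normr_eq0 eq_le normr_ge0 andbT (le_trans (clin_norm_ge _ _))// f0 mul0r.
Qed.

HB.instance Definition _ :=
  Lmodule_isNormed.Build R clin clin_normD clin_normZ clin_norm_eq0.

End ContinuousLinear.
Arguments clin {R} V W.

(* [f] is n times continuously Frechet differentiable on the open set [U];
   [clin V W] carries the operator norm. *)
Fixpoint Cn_on {R : realType} {V : normedModType R} (n : nat) (U : set V)
    {W : normedModType R} (f : V -> W) : Prop :=
  match n with
  | 0 => forall x, U x -> {for x, continuous f}
  | m.+1 => (forall x, U x -> differentiable f x) /\
      exists df : V -> clin V W,
        (forall x, U x -> clin_val (df x) = 'd f x) /\ Cn_on m U df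
  end.

Definition smooth_on {R : realType} {V W : normedModType R} (U : set V)
  (f : V -> W) := forall n, Cn_on n U f.

Section LiePoisson.
Context {R : realType}.

(* [GIinf], [linf * linf] and [l1 * l1] encode g_0 + g_{k-1} S^(k-1),
   x_0 + x_{k-1} S^(k-1) and rho_0 + (S^T)^(k-1) rho_{k-1} by their pairs of
   coefficient sequences; a pair (q, p) in the phase space also has type
   [linf * l1]. *)
Record GIinf := GI {
  gi0 : linf R;
  gik : linf R;
  gi0_lb : exists2 c : R, 0 < c & forall n, c <= gi0 n
}.

Lemma gi0_gt0 (g : GIinf) n : 0 < gi0 g n.
Proof. by have [c c0 /(_ n)] := gi0_lb g; exact: lt_le_trans. Qed.

Fact gi0_inv_subproof (g : GIinf) : (fun n => (gi0 g n)^-1) \in linf_pred.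
Proof.
have [c c0 gc] := gi0_lb g; apply/linf_predP; exists c^-1 => n.
by rewrite ger0_norm ?invr_ge0 ?(ltW (gi0_gt0 _ _))// lef_pV2 ?posrE ?gi0_gt0.
Qed.
Definition gi0_inv (g : GIinf) : linf R := Linf (gi0_inv_subproof g).

Fact gi0_log_subproof (g : GIinf) : (fun n => ln (gi0 g n)) \in linf_pred.
Proof.
have [c c0 gc] := gi0_lb g; have [M gM] := linf_bounded (gi0 g).
apply/linf_predP; exists (`|ln c| + `|ln M|) => n.
have gn0 := gi0_gt0 g n.
have gnM : gi0 g n <= M by rewrite (le_trans (ler_norm _)).
have M0 : 0 < M by exact: lt_le_trans gnM.
have l1c : ln c <= ln (gi0 g n) by rewrite ler_ln ?posrE.
have l2c : ln (gi0 g n) <= ln M by rewrite ler_ln ?posrE.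
rewrite ler_norml; apply/andP; split.
  by rewrite (le_trans _ l1c)// lerNl (le_trans (ler_norm _))// normrN lerDl.
by rewrite (le_trans l2c)// (le_trans (ler_norm _))// lerDr.
Qed.
Definition gi0_log (g : GIinf) : linf R := Linf (gi0_log_subproof g).

Variable k : nat.

Fact gi_mul_subproof (g h : GIinf) :
  exists2 c : R, 0 < c & forall n, c <= (gi0 g ** gi0 h) n.
Proof.
have [c c0 gc] := gi0_lb g; have [d d0 hd] := gi0_lb h.
by exists (c * d) => [|n]; [exact: mulr_gt0 | rewrite ler_pM// ltW].
Qed.
Definition gi_mul (g h : GIinf) : GIinf :=
  GI (gi0 g ** gik h + gik g ** s^(k.-1) (gi0 h)) (gi_mul_subproof g h).

Lemma gi0_mulE (g h : GIinf) n : gi0 (gi_mul g h) n = gi0 g n * gi0 h n.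
Proof. by []. Qed.

Lemma gik_mulE (g h : GIinf) n : gik (gi_mul g h) n =
  gi0 g n * gik h n + gik g n * (s^(k.-1) (gi0 h)) n.
Proof. by []. Qed.

Lemma shiftE m (x : linf R) n : (s^(m) x) n = x (n + m)%N.
Proof. by elim: m n => [|m IH] n; rewrite ?addn0// iterS /= IH addSnnS. Qed.

Lemma unshiftE m (r : l1 R) n : (st^(m) r) n = if (n < m)%N then 0 else r (n - m)%N.
Proof. by elim: m n => [|m IH] [|n] //=; rewrite IH. Qed.

Definition GL0 : set GIinf := [set g | gik g = 0 /\ s^(k.-1) (gi0 g) = gi0 g].

Definition delta (rho : l1 R * l1 R) : l1 R := rho.2.

(* the inclusion of L^1_{-k+1} in the predual *)
Definition predual_incl (r : l1 R) : l1 R * l1 R := (0, r).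

Definition alpha (g : GIinf) (r : l1 R) : l1 R :=
  (s^(k.-1) (gi0 g) ** gi0_inv g) *** r.

Definition Delta (nu : l1 R) : set (l1 R) := range (fun g => alpha g nu).

(* [coad g] is (Ad^{+,k})^*_{g^{-1}}, a left action. *)
Definition coad (g : GIinf) (rho : l1 R * l1 R) : l1 R * l1 R :=
  let a := (gi0_inv g ** gik g) *** rho.2 in
  (rho.1 + a - st^(k.-1) a, (s^(k.-1) (gi0 g) ** gi0_inv g) *** rho.2).

Definition coad_orbit (rho : l1 R * l1 R) : set (l1 R * l1 R) :=
  range (fun g => coad g rho).

Definition sigma (nu : l1 R) (g : GIinf) (x : linf R * l1 R) : linf R * l1 R :=
  let a := (gik g ** gi0_inv g) *** (linf_exp (s^(k.-1) x.1 - x.1) *** nu) in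
  (x.1 + gi0_log g, x.2 + a - st^(k.-1) a).

Definition sigma_GL0_orbit (nu : l1 R) (x : linf R * l1 R) : set (linf R * l1 R) :=
  [set sigma nu g x | g in GL0].

Definition Jmap (nu : l1 R) (x : linf R * l1 R) : l1 R * l1 R :=
  (x.2, linf_exp (s^(k.-1) x.1 - x.1) *** nu).

Lemma alphaM (g h : GIinf) r : alpha (gi_mul g h) r = alpha g (alpha h r).
Proof.
apply: l1_eqP => n; rewrite /= !shiftE /= invfM; ring.
Qed.

Lemma coadM (g h : GIinf) rho : coad (gi_mul g h) rho = coad g (coad h rho).
Proof.
have a n : (gi0_inv (gi_mul g h) ** gik (gi_mul g h) *** rho.2) n =
    (gi0_inv h ** gik h *** rho.2) n + (gi0_inv g ** gik g *** (coad h rho).2) n.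
  have := gi0_gt0 g n; have := gi0_gt0 h n => /lt0r_neq0 h0 /lt0r_neq0 g0.
  rewrite -[LHS]/((gi0 (gi_mul g h) n)^-1 * gik (gi_mul g h) n * rho.2 n).
  by rewrite gik_mulE gi0_mulE /= !shiftE /=; field; rewrite h0 g0.
congr pair; apply: l1_eqP => n; last first.
  by rewrite /= !shiftE /= invfM; ring.
pose A g r := gi0_inv g ** gik g *** r.
rewrite -[LHS]/(rho.1 n + A (gi_mul g h) rho.2 n
  - (st^(k.-1) (A (gi_mul g h) rho.2)) n).
rewrite -[RHS]/(rho.1 n + A h rho.2 n - (st^(k.-1) (A h rho.2)) n
  + A g (coad h rho).2 n - (st^(k.-1) (A g (coad h rho).2)) n).
rewrite !unshiftE !a.
by case: ifP => _; ring.
Qed.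

Lemma sigmaM nu (g h : GIinf) x :
  sigma nu (gi_mul g h) x = sigma nu g (sigma nu h x).
Proof.
pose E (y : linf R) := linf_exp (s^(k.-1) y - y) *** nu.
have a n : (gik (gi_mul g h) ** gi0_inv (gi_mul g h) *** E x.1) n =
    (gik h ** gi0_inv h *** E x.1) n +
    (gik g ** gi0_inv g *** E (sigma nu h x).1) n.
  have h0 := gi0_gt0 h n; have hk := gi0_gt0 h (n + k.-1)%N.
  have g0 := gi0_gt0 g n.
  have Eh : E (sigma nu h x).1 n = E x.1 n * (gi0 h (n + k.-1)%N / gi0 h n).
    rewrite -[LHS]/(expR ((s^(k.-1) (x.1 + gi0_log h)) n -
      (x.1 n + ln (gi0 h n))) * nu n).
    rewrite -[E x.1 n]/(expR ((s^(k.-1) x.1) n - x.1 n) * nu n) !shiftE.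
    rewrite -[(_ + gi0_log h) _]/(_ + ln (gi0 h (n + k.-1)%N)).
    rewrite opprD addrACA expRD [expR (ln _ - _)]expRB !lnK ?posrE//; ring.
  rewrite -[LHS]/(gik (gi_mul g h) n * (gi0 (gi_mul g h) n)^-1 * E x.1 n).
  rewrite gik_mulE gi0_mulE shiftE -[RHS]/(gik h n / gi0 h n * E x.1 n +
    gik g n / gi0 g n * E (sigma nu h x).1 n) Eh.
  by move: (E _ _) => e; field; rewrite !gt_eqF.
congr pair; last first.
  apply: l1_eqP => n.
  pose A g r := gik g ** gi0_inv g *** r.
  pose y := sigma nu h x.
  rewrite -[LHS]/(x.2 n + A (gi_mul g h) (E x.1) n
    - (st^(k.-1) (A (gi_mul g h) (E x.1))) n).
  rewrite -[RHS]/(x.2 n + A h (E x.1) n - (st^(k.-1) (A h (E x.1))) n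
    + A g (E y.1) n - (st^(k.-1) (A g (E y.1))) n).
  rewrite !unshiftE !a.
  by case: ifP => _; ring.
apply: linf_eqP => n.
rewrite -[LHS]/(x.1 n + ln (gi0 g n * gi0 h n)).
rewrite -[RHS]/(x.1 n + ln (gi0 h n) + ln (gi0 g n)).
rewrite lnM ?posrE ?gi0_gt0//; ring.
Qed.

Definition pairing (q : linf R) (p : l1 R) : R := limn (series (fun i => q i * p i)).

Definition omega (u v : linf R * l1 R) : R := pairing u.1 v.2 - pairing v.1 u.2.

(* [v |-> 'd f x (v, 0)] is the partial derivative of f along l^oo. *)
Definition C_omega (U : set (linf R * l1 R)) (f : linf R * l1 R -> R) : Prop :=
  smooth_on U f /\
  forall x, U x -> exists b : l1 R, forall v, 'd f x (v, 0) = pairing v b.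

(* [X] is unique if it exists (omega is weakly nondegenerate), and it exists
   for f in C_omega; otherwise [get] returns an arbitrary point. *)
Definition ham_vf (f : linf R * l1 R -> R) (x : linf R * l1 R) : linf R * l1 R :=
  get [set X | forall v, 'd f x v = omega X v].

Definition bracket_omega (f g : linf R * l1 R -> R) (x : linf R * l1 R) : R :=
  omega (ham_vf f x) (ham_vf g x).

Definition tr (rho : l1 R * l1 R) (x : linf R * linf R) : R :=
  pairing x.1 rho.1 + pairing x.2 rho.2.

Definition lie_bracket (x y : linf R * linf R) : linf R * linf R :=
  (0, x.2 ** (s^(k.-1) y.1 - y.1) - y.2 ** (s^(k.-1) x.1 - x.1)).

(* The differential of f at rho, as an element of l^oo x l^oo, the dual of
   l^1 x l^1 through [tr]; it is unique, and exists if f is differentiable. *)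
Definition grad (f : l1 R * l1 R -> R) (rho : l1 R * l1 R) : linf R * linf R :=
  get [set x | forall eta, 'd f rho eta = tr eta x].

Definition lie_poisson (f h : l1 R * l1 R -> R) (rho : l1 R * l1 R) : R :=
  tr rho (lie_bracket (grad f rho) (grad h rho)).

Definition momentum_map (F : linf R * l1 R -> l1 R * l1 R) : Prop :=
  smooth_on setT F /\
  forall (U : set (l1 R * l1 R)) (phi psi : l1 R * l1 R -> R),
    open U -> smooth_on U phi -> smooth_on U psi ->
    C_omega (F @^-1` U) (phi \o F) -> C_omega (F @^-1` U) (psi \o F) ->
    forall x, U (F x) ->
      bracket_omega (phi \o F) (psi \o F) x = lie_poisson phi psi (F x).

End LiePoisson.
Arguments GIinf : clear implicits.

(* Main.v *)
Require Import Defs.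
From HB Require Import structures.
From mathcomp Require Import all_boot all_order all_algebra.
From mathcomp Require Import ring lra.
From mathcomp Require Import all_classical all_reals all_analysis.
Set Implicit Arguments.
Unset Strict Implicit.
Unset Printing Implicit Defensive.
Import Order.TTheory GRing.Theory Num.Theory.
Import numFieldNormedType.Exports.
Local Open Scope classical_set_scope.
Local Open Scope ring_scope.

(* With e = nu exp (s^(k-1) q - q), the chain rule and summation by parts give
   the Hamiltonian vector field (a_0, a_k e - st^(k-1) (a_k e)) for f \o J, where
   (a_0, a_k) is the gradient of f; inserting it into omega yields the
   Lie-Poisson bracket. Under q |-> q + log g_0 the sequence e is multiplied by
   s^(k-1)(g_0) / g_0, so J intertwines sigma with the coadjoint action; as every
   q is log g_0 for some g, all of Delta is reached. If nu has no zero entry, e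
   determines q up to a (k-1)-periodic sequence, that is, up to GL_0. *)

(** * Bounded linear and bilinear maps between normed spaces *)

Section BoundedLinear.
Context {R : realType}.
Implicit Types U V W X : normedModType R.

Lemma bounded_clin V W (f : V -> W) (M : R) :
  linear f -> (forall x, `|f x| <= M * `|x|) -> f \in @clin_pred R V W.
Proof.
move=> lf fM; apply/asboolP; split => //.
pose F : {linear V -> W} := HB.pack f (GRing.isLinear.Build _ _ _ _ f lf).
rewrite -[f]/(F : V -> W); apply/linear_bounded_continuous/bounded_funP => r.
exists (`|M| * r) => x xr; rewrite (le_trans (fM x))//.
by rewrite (le_trans (ler_wpM2r _ (ler_norm M)))// ler_wpM2l.
Qed.

Lemma clin_norm_bound V W (f : clin V W) (M : R) :
  0 <= M -> (forall x, `|f x| <= M * `|x|) -> `|f| <= M.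
Proof.
move=> M0 fM; apply: clin_norm_le => x x1.
by rewrite (le_trans (fM x))// ler_piMr.
Qed.

Lemma le_clin_norm V W (f : clin V W) x : `|f x| <= `|f| * `|x|.
Proof. exact: clin_norm_ge. Qed.

Lemma clinP V W (f : clin V W) a u v : f (a *: u + v) = a *: f u + f v.
Proof. exact: clin_linear. Qed.

Section Composition.
Variables U V W : normedModType R.

Fact clin_comp_subproof (g : clin V W) (f : clin U V) : g \o f \in @clin_pred R U W.
Proof.
apply: (@bounded_clin _ _ _ (`|g| * `|f|)) => [a u v|x] /=; first by rewrite !clinP.
by rewrite (le_trans (le_clin_norm _ _))// -mulrA ler_wpM2l// le_clin_norm.
Qed.
Definition clin_comp (g : clin V W) (f : clin U V) : clin U W := Clin (clin_comp_subproof g f).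

Lemma clin_comp_norm g f : `|clin_comp g f| <= `|g| * `|f|.
Proof.
apply: clin_norm_bound => [|x]; first exact: mulr_ge0.
by rewrite (le_trans (le_clin_norm g _))// -mulrA ler_wpM2l// le_clin_norm.
Qed.

Fact clin_postcomp_subproof g : clin_comp g \in @clin_pred R (clin U V) (clin U W).
Proof.
apply: (@bounded_clin _ _ _ `|g|) => [a u v|]; last exact: clin_comp_norm.
by apply: clin_eqP => x; rewrite /= clinP.
Qed.
Definition clin_postcomp g : clin (clin U V) (clin U W) := Clin (clin_postcomp_subproof g).

(** Bilinear maps are kept in curried form. Composition is one of them, with norm at most 1, so the
    chain rule expresses the derivative of a composite as a bilinear expression in two
    derivatives. *)
Fact clin_bicomp_subproof : clin_postcomp \in @clin_pred R (clin V W) (clin (clin U V) (clin U W)).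
Proof.
apply: (@bounded_clin _ _ _ 1) => [a g h|g].
  by apply: clin_eqP => f; exact: clin_eqP.
by rewrite mul1r; apply: clin_norm_bound => // f; exact: clin_comp_norm.
Qed.
Definition clin_bicomp : clin (clin V W) (clin (clin U V) (clin U W)) := Clin clin_bicomp_subproof.

Variable B : clin U (clin V W).

Lemma bilin_norm u v : `|B u v| <= `|B| * `|u| * `|v|.
Proof.
by rewrite (le_trans (le_clin_norm _ _))// ler_wpM2r// le_clin_norm.
Qed.

Fact clin_flip1_subproof v : B ^~ v \in @clin_pred R U W.
Proof.
apply: (@bounded_clin _ _ _ (`|B| * `|v|)) => [a x y|x]; first by rewrite clinP.
by rewrite mulrAC bilin_norm.
Qed.
Definition clin_flip1 v : clin U W := Clin (clin_flip1_subproof v).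

Fact clin_flip_subproof : clin_flip1 \in @clin_pred R V (clin U W).
Proof.
apply: (@bounded_clin _ _ _ `|B|) => [a x y|v].
  by apply: clin_eqP => u; rewrite /= clinP.
apply: clin_norm_bound => [|u]; first exact: mulr_ge0.
by rewrite mulrAC bilin_norm.
Qed.
Definition clin_flip : clin V (clin U W) := Clin clin_flip_subproof.

Lemma bilin_continuous : continuous (fun p : U * V => B p.1 p.2).
Proof.
move=> p.
(* This bounds the increment of [B] after splitting it as [B (q.1 - p.1) q.2 + B p.1 (q.2 - p.2)];
   it tends to 0 at [p]. *)
pose M (q : U * V) : R := `|B| * (`|q.1 - p.1| * `|q.2| + `|p.1| * `|q.2 - p.2|).
have M0 : M q @[q --> p] --> (0 : R).
  rewrite (_ : 0 = M p); last by rewrite /M !subrr !normr0 mul0r mulr0 addr0 mulr0.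
  apply: cvgM; first exact: cvg_cst.
  apply: cvgD; apply: cvgM; [| |exact: cvg_cst|].
  - by apply: cvg_norm; apply: cvgB; [exact: cvg_fst|exact: cvg_cst].
  - by apply: cvg_norm; exact: cvg_snd.
  - by apply: cvg_norm; apply: cvgB; [exact: cvg_snd|exact: cvg_cst].
suff H : `|B q.1 q.2 - B p.1 p.2| @[q --> p] --> (0 : R).
  exact: (cvg_zero (norm_cvg0 H)).
apply: (squeeze_cvgr _ (cvg_cst 0) M0).
apply: nearW => q; rewrite normr_ge0/= /M.
have -> : B q.1 q.2 - B p.1 p.2 = B (q.1 - p.1) q.2 + B p.1 (q.2 - p.2).
  have -> : B (q.1 - p.1) = B q.1 - B p.1 by exact: linearB.
  have -> : B p.1 (q.2 - p.2) = B p.1 q.2 - B p.1 p.2 by exact: linearB.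
  by rewrite addrA subrK.
rewrite (le_trans (ler_normD _ _))// mulrDr lerD//.
  by rewrite mulrA bilin_norm.
by rewrite mulrA bilin_norm.
Qed.

Lemma is_diff_bilin (X : normedModType R) (f df : X -> U) (g dg : X -> V) x :
  is_diff x f df -> is_diff x g dg ->
  is_diff x (fun x => B (f x) (g x)) (fun h => B (df h) (g x) + B (f x) (dg h)).
Proof.
move=> dfx dgx; pose b u v := B u v.
have bP : bilinear_for (GRing.Scale.Law.clone _ _ *:%R _)
    (GRing.Scale.Law.clone _ _ *:%R _) b.
  by split=> u a y z; rewrite /b clinP.
pose bb : {bilinear U -> V -> W} :=
  HB.pack b (bilinear_isBilinear.Build R U V W _ _ b bP).
have bc : continuous (fun p : U * V => bb p.1 p.2) by exact: bilin_continuous.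
have db : is_diff (f x, g x) (fun p : U * V => bb p.1 p.2)
    (fun q => bb (f x) q.2 + bb q.1 (g x)).
  by apply: DiffDef; [exact: differentiable_bilin|exact: diff_bilin].
have -> : (fun x => B (f x) (g x)) = (fun p : U * V => bb p.1 p.2) \o (fun y => (f y, g y)).
  by [].
apply: is_diff_eq; apply/funext => h /=; exact: addrC.
Qed.

End Composition.
End BoundedLinear.

(** * Differentiability of order n under sums, bilinear maps and composition *)

Section Smooth.
Context {R : realType}.
Implicit Types U V W X : normedModType R.

Lemma Cn_onS n V W (A : set V) (f : V -> W) : Cn_on n.+1 A f <->
  exists df : V -> clin V W,
    (forall x, A x -> is_diff x f (df x)) /\ Cn_on n A df.
Proof.
split=> [[fd [df [dfE Cdf]]]|[df [fdf Cdf]]].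
  exists df; split => // x Ax; split; first exact: fd.
  by rewrite dfE.
split=> [x /fdf[]//|]; exists df; split => // x /fdf fx.
exact/esym/(@diff_val _ _ _ _ _ _ _ fx).
Qed.

(** Used for products and composites, whose derivatives contain the original maps besides their
    derivatives. *)
Lemma Cn_on_pred n V W (A : set V) (f : V -> W) : Cn_on n.+1 A f -> Cn_on n A f.
Proof.
elim: n W f => [|n IH] W f.
  by move=> [fd _] x /fd; exact: differentiable_continuous.
move=> /Cn_onS[df [fdf /IH Cdf]]; apply/Cn_onS.
by exists df.
Qed.

Lemma Cn_on_cst n V W (A : set V) (c : W) : Cn_on n A (fun _ : V => c).
Proof.
elim: n W c => [|n IH] W c; first by move=> x _; exact: cst_continuous.
apply/Cn_onS; exists (fun=> 0); split => // x _.
exact: is_diff_cst.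
Qed.

Lemma is_diff_clin V W (L : clin V W) x : is_diff x L L.
Proof.
have Lc := @clin_continuous _ _ _ L.
by split; [exact: linear_differentiable|exact: diff_lin].
Qed.

Lemma Cn_on_clin n V W (A : set V) (L : clin V W) : Cn_on n A L.
Proof.
case: n => [|n]; first by move=> x _; exact: clin_continuous.
apply/Cn_onS; exists (fun=> L); split; last exact: Cn_on_cst.
by move=> x _; exact: is_diff_clin.
Qed.

Lemma Cn_onD n V W (A : set V) (f g : V -> W) :
  Cn_on n A f -> Cn_on n A g -> Cn_on n A (fun x => f x + g x).
Proof.
elim: n W f g => [|n IH] W f g.
  by move=> fc gc x Ax; apply: continuousD; [exact: fc|exact: gc].
move=> /Cn_onS[df [fdf Cdf]] /Cn_onS[dg [gdg Cdg]]; apply/Cn_onS.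
exists (fun x => df x + dg x); split; last exact: IH.
move=> x Ax; have fx := fdf x Ax; have gx := gdg x Ax.
exact: is_diffD.
Qed.

(** The derivative is again a fixed continuous linear map, [clin_postcomp _ L], applied to [df];
    hence the induction varies the spaces. *)
Lemma Cn_on_clin_comp n V W X (A : set V) (L : clin W X) (f : V -> W) :
  Cn_on n A f -> Cn_on n A (fun x => L (f x)).
Proof.
elim: n W X L f => [|n IH] W X L f.
  by move=> fc x Ax; apply: continuous_comp; [exact: fc|exact: clin_continuous].
move=> /Cn_onS[df [fdf Cdf]]; apply/Cn_onS.
exists (fun x => clin_postcomp _ L (df x)); split; last exact: IH.
move=> x Ax; have fx := fdf x Ax; have Lx := is_diff_clin L (f x).
exact: is_diff_comp.
Qed.

Lemma Cn_on_bilin n V W X Y (A : set V) (B : clin W (clin X Y))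
  (f : V -> W) (g : V -> X) :
  Cn_on n A f -> Cn_on n A g -> Cn_on n A (fun x => B (f x) (g x)).
Proof.
elim: n W X Y B f g => [|n IH] W X Y B f g.
  move=> fc gc x Ax.
  apply: (@continuous_comp _ _ _ (fun x => (f x, g x)) (fun p => B p.1 p.2)).
    by apply: cvg_pair; [exact: fc|exact: gc].
  exact: bilin_continuous.
move=> Cf Cg; have [Cf' Cg'] := (Cn_on_pred Cf, Cn_on_pred Cg).
move: Cf Cg => /Cn_onS[df [fdf Cdf]] /Cn_onS[dg [gdg Cdg]]; apply/Cn_onS.
(* The product rule: each summand is a bilinear map evaluated at functions of class n, to which the
   induction hypothesis for all bilinear maps applies. *)
exists (fun x => clin_bicomp _ _ _ (clin_flip B (g x)) (df x) + clin_bicomp _ _ _ (B (f x)) (dg x)).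
split; last by apply: Cn_onD; apply: IH => //; exact: Cn_on_clin_comp.
move=> x Ax; have fx := fdf x Ax; have gx := gdg x Ax.
exact: is_diff_bilin.
Qed.

Lemma Cn_on_comp n V W X (A : set V) (D : set W) (f : V -> W) (g : W -> X) :
  (forall x, A x -> D (f x)) -> Cn_on n A f -> Cn_on n D g -> Cn_on n A (g \o f).
Proof.
move=> AD; elim: n X g => [|n IH] X g.
  by move=> fc gc x Ax; apply: continuous_comp; [exact: fc|exact/gc/AD].
move=> Cf; have Cf' := Cn_on_pred Cf.
move: Cf => /Cn_onS[df [fdf Cdf]] /Cn_onS[dg [gdg Cdg]]; apply/Cn_onS.
(* The chain rule: [dg \o f] is of class n by induction, and composing it with [df] is bilinear. *)
exists (fun x => clin_bicomp _ _ _ ((dg \o f) x) (df x)); split.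
  move=> x Ax; have fx := fdf x Ax; have gx := gdg _ (AD x Ax).
  exact: is_diff_comp.
by apply: Cn_on_bilin => //; exact: IH.
Qed.

End Smooth.

(** * Exponential on l^oo, pairing of l^oo with l^1, and the dual of l^1 *)

Section SequenceSpaces.
Context {R : realType}.
Local Open Scope seq_space_scope.
Implicit Types (x y : linf R) (p r : l1 R).

Lemma is_diff_quadratic (V W : normedModType R) (f : V -> W) (L : clin V W) (x : V)
    (d C : R) : 0 < d ->
    (forall h, `|h| <= d -> `|f (h + x) - (f x + L h)| <= C * `|h| ^+ 2) ->
  is_diff x f L.
Proof.
move=> d0 fC.
have o : f \o shift x = cst (f x) + L +o_ 0 id.
  apply/eqaddoP => e e0.
  have C0 : 0 < `|C| + 1 by rewrite ltr_pwDr.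
  near=> h.
  have hd : `|h| <= d.
    near: h; apply: nbhs0_le => //.
  (* On this ball [C * |h|^2] is at most [e * |h|]; adding 1 keeps the divisor positive. *)
  have he : `|h| <= e / (`|C| + 1).
    near: h; apply: nbhs0_le; exact: divr_gt0.
  rewrite [leLHS](_ : _ = `|f (h + x) - (f x + L h)|)//.
  rewrite (le_trans (fC h hd))// expr2 mulrA ler_wpM2r//.
  rewrite (le_trans (ler_wpM2r _ (ler_norm C)))//.
  rewrite (@le_trans _ _ ((`|C| + 1) * `|h|))//; first by rewrite ler_wpM2r// lerDl.
  by rewrite mulrC -ler_pdivlMr.
have dE : 'd f x = L :> (V -> W) by exact/diff_unique/o/clin_continuous.
split => //; apply/diff_locallyP; rewrite dE; split => //.
exact: clin_continuous.
Unshelve. all: by end_near. Qed.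

(** The tangent bound at [t] and at [- t] gives 1 + t <= exp t <= 1 / (1 - t), and 1 / (1 - t) - 1 -
    t = t^2 / (1 - t) <= 2 t^2 for t <= 1/2. *)
Lemma expR_quadratic (t : R) : `|t| <= 2^-1 -> `|expR t - (1 + t)| <= 2 * `|t| ^+ 2.
Proof.
rewrite real_normK ?num_real// ler_norml => /andP[tl tu].
have e1 := expR_ge1Dx t; have e2 := expR_ge1Dx (- t).
rewrite ger0_norm ?subr_ge0//.
have e0 := expR_gt0 t.
have : expR t * (1 - t) <= 1.
  by rewrite -[leRHS](mulfV (lt0r_neq0 e0)) -expRN ler_wpM2l// ltW.
move: (expR t) e0 e1 => z z0 z1 z2.
nra.
Qed.

Lemma le_linf_norm x n : `|x n| <= `|x|.
Proof. exact: linf_norm_ge. Qed.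

Fact linf_mul1_subproof x : linf_mul x \in @clin_pred R (linf R) (linf R).
Proof.
apply: (@bounded_clin _ _ _ _ `|x|) => [a y z|y].
  apply: linf_eqP => n; rewrite /= -[LHS]/(x n * (a * y n + z n)).
  rewrite -[RHS]/(a * (x n * y n) + x n * z n); ring.
by apply: linf_norm_le => n; rewrite normrM ler_pM// le_linf_norm.
Qed.
Definition linf_mul1 x : clin (linf R) (linf R) := Clin (linf_mul1_subproof x).

Fact linf_mulL_subproof : linf_mul1 \in @clin_pred R (linf R) (clin (linf R) (linf R)).
Proof.
apply: (@bounded_clin _ _ _ _ 1) => [a y z|x].
  apply: clin_eqP => w; apply: linf_eqP => n /=.
  rewrite -[LHS]/((a * y n + z n) * w n) -[RHS]/(a * (y n * w n) + z n * w n).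
  ring.
rewrite mul1r; apply: clin_norm_bound => // y.
by apply: linf_norm_le => n; rewrite normrM ler_pM// le_linf_norm.
Qed.
Definition linf_mulL : clin (linf R) (clin (linf R) (linf R)) := Clin linf_mulL_subproof.

(** Entrywise the remainder is exp x (exp h - 1 - h); since every entry of [h] is at most the norm
    of [h], the scalar estimate is uniform in the index. *)
Lemma is_diff_linf_exp x : is_diff x linf_exp (linf_mul1 (linf_exp x)).
Proof.
apply: (@is_diff_quadratic _ _ _ _ _ 2^-1 (`|linf_exp x| * 2)) => // h hd.
apply: linf_norm_le => n.
rewrite -[X in `|X|]/(expR (h n + x n) - (expR (x n) + expR (x n) * h n)).
rewrite expRD mulrC -[X in _ - (X + _)]mulr1 -mulrDr -mulrBr normrM -mulrA.
have hn := le_linf_norm h n.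
rewrite ler_pM//; first exact: (le_linf_norm (linf_exp x) n).
rewrite (le_trans (expR_quadratic (le_trans hn hd)))// ler_wpM2l//.
by rewrite lerXn2r// nnegrE.
Qed.

(** The derivative is the exponential itself followed by the continuous linear map [linf_mulL], so
    each order yields the next. *)
Lemma Cn_on_linf_exp n (A : set (linf R)) : Cn_on n A linf_exp.
Proof.
elim: n => [|n IH].
  by move=> x _; apply: differentiable_continuous; have [] := is_diff_linf_exp x.
apply/Cn_onS; exists (fun x => linf_mulL (linf_exp x)); split.
  by move=> x _; exact: is_diff_linf_exp.
exact: Cn_on_clin_comp.
Qed.

Fact linf_shiftL_subproof m : iter m linf_shift \in @clin_pred R (linf R) (linf R).
Proof.
apply: (@bounded_clin _ _ _ _ 1) => [a y z|y].
  by apply: linf_eqP => n; rewrite shiftE -[RHS]/(a * (s^(m) y) n + (s^(m) z) n) !shiftE.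
by rewrite mul1r; apply: linf_norm_le => n; rewrite shiftE le_linf_norm.
Qed.
Definition linf_shiftL m : clin (linf R) (linf R) := Clin (linf_shiftL_subproof m).

Lemma l1_mul_norm x r : `|x *** r| <= `|x| * `|r|.
Proof.
apply: l1_norm_le => n; apply: (@le_trans _ _ (`|x| * [normed series r] n)).
  rewrite /= /series/= mulr_sumr ler_sum// => i _.
  by rewrite normrM ler_wpM2r// le_linf_norm.
by rewrite ler_wpM2l//; exact: l1_norm_ge.
Qed.

Lemma cvg_pairing x r : cvgn (series (fun i => x i * r i)).
Proof. exact: normed_cvg (l1_cvg (x *** r)). Qed.
Arguments cvg_pairing : clear implicits.

Lemma pairing_linear_l r a x y : pairing (a *: x + y) r = a * pairing x r + pairing y r.
Proof.
have cx := cvg_pairing x r; have cy := cvg_pairing y r.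
apply/cvg_lim => //.
rewrite [X in X @ _ --> _](_ : _ = (fun n => a * series (fun i => x i * r i) n
   + series (fun i => y i * r i) n)).
  by apply: cvgD => //; apply: cvgM => //; exact: cvg_cst.
apply/funext => n; rewrite /series/= mulr_sumr -big_split/=; apply: eq_bigr => i _.
rewrite -[LHS]/((a * x i + y i) * r i); ring.
Qed.

Lemma pairing_linear_r x a p r : pairing x (a *: p + r) = a * pairing x p + pairing x r.
Proof.
have cx := cvg_pairing x p; have cy := cvg_pairing x r.
apply/cvg_lim => //.
rewrite [X in X @ _ --> _](_ : _ = (fun n => a * series (fun i => x i * p i) n
   + series (fun i => x i * r i) n)).
  by apply: cvgD => //; apply: cvgM => //; exact: cvg_cst.
apply/funext => n; rewrite /series/= mulr_sumr -big_split/=; apply: eq_bigr => i _.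
rewrite -[LHS]/(x i * (a * p i + r i)); ring.
Qed.

Lemma pairing0l r : pairing (0 : linf R) r = 0.
Proof. by rewrite -[X in pairing X _](addNr 0) -scaleN1r pairing_linear_l mulN1r addNr. Qed.

Lemma pairing0r x : pairing x (0 : l1 R) = 0.
Proof. by rewrite -[X in pairing _ X](addNr 0) -scaleN1r pairing_linear_r mulN1r addNr. Qed.

Lemma pairingBl x y r : pairing (x - y) r = pairing x r - pairing y r.
Proof. by rewrite addrC -scaleN1r pairing_linear_l mulN1r addrC. Qed.

Lemma pairingBr x p r : pairing x (p - r) = pairing x p - pairing x r.
Proof. by rewrite addrC -scaleN1r pairing_linear_r mulN1r addrC. Qed.

Lemma pairing_mul x y r : pairing (x ** y) r = pairing x (y *** r).
Proof.
congr (limn (series _)); apply/funext => i; exact/esym/mulrA.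
Qed.

Lemma linf_mulC x y : x ** y = y ** x.
Proof. by apply: linf_eqP => n; exact: mulrC. Qed.

(** Shifts are removed one at a time: an unshifted sequence starts with 0, so its partial sum of
    length n + 1 is the partial sum of length n on the other side. *)
Lemma pairing_shift m x r : pairing (s^(m) x) r = pairing x (st^(m) r).
Proof.
elim: m r => // m IH r; rewrite [in RHS]iterSr -IH iterS; set y := s^(m) x.
apply/esym/cvg_lim => //; rewrite -cvg_shiftS.
rewrite [X in X @ _ --> _](_ : _ = series (fun i => y i.+1 * r i)).
  exact: (cvg_pairing (linf_shift y) r).
by apply/funext => n; rewrite /series/= big_nat_recl//= mulr0 add0r.
Qed.

Lemma series_delta_le1 n m : [normed series (fun i => (i == n)%:R : R)] m <= 1.
Proof.
rewrite /= /series/= big_mkord; under eq_bigr do rewrite normr_nat.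
case: (ltnP n m) => nm.
  rewrite (bigD1 (Ordinal nm))//= eqxx big1 ?addr0// => i /eqP ni.
  by rewrite (negbTE (introN eqP _))// => iE; apply: ni; exact: val_inj.
by rewrite big1// => i _; rewrite (ltn_eqF (leq_trans (ltn_ord i) nm)).
Qed.

Fact l1_delta_subproof (n : nat) : (fun i => (i == n)%:R) \in @l1_pred R.
Proof. by apply/l1_predP; exists 1 => m; exact: series_delta_le1. Qed.
Definition l1_delta n : l1 R := L1 (l1_delta_subproof n).

Lemma l1_delta_norm n : `|l1_delta n| <= 1.
Proof. by apply: l1_norm_le => m; exact: series_delta_le1. Qed.

Fact linf_delta_subproof (n : nat) : (fun i => (i == n)%:R) \in @linf_pred R.
Proof. by apply/linf_predP; exists 1 => m; case: eqP => _; rewrite ?normr1 ?normr0. Qed.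
Definition linf_delta n : linf R := Linf (linf_delta_subproof n).

Lemma pairing_single x r n : (forall i, i != n -> x i * r i = 0) ->
  pairing x r = x n * r n.
Proof.
move=> xr0; apply/cvg_lim => //; apply: cvg_near_cst.
exists n.+1 => // m /= nm; apply/eqP; rewrite /series/= big_mkord (bigD1 (Ordinal nm))//=.
rewrite big1 ?addr0// => i ni; apply: xr0; apply: contra ni => /eqP ni.
by apply/eqP/val_inj.
Qed.

Lemma pairing_l1_delta x n : pairing x (l1_delta n) = x n.
Proof.
rewrite (@pairing_single _ _ n) => [|i /negbTE /= ->]; last by rewrite mulr0n mulr0.
by rewrite /= eqxx mulr1.
Qed.

Lemma pairing_linf_delta n r : pairing (linf_delta n) r = r n.
Proof.
rewrite (@pairing_single _ _ n) => [|i /negbTE /= ->]; last by rewrite mulr0n mul0r.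
by rewrite /= eqxx mul1r.
Qed.

(** Unit sequences recover every entry. This nondegeneracy makes gradients and Hamiltonian vector
    fields unique. *)
Lemma pairing_inj_l x y : pairing x =1 pairing y -> x = y.
Proof. by move=> xy; apply: linf_eqP => n; rewrite -!pairing_l1_delta xy. Qed.

Lemma pairing_inj_r p r : pairing^~ p =1 pairing^~ r -> p = r.
Proof. by move=> pr; apply: l1_eqP => n; rewrite -!pairing_linf_delta; exact: pr. Qed.

Let l1_trunc n r : l1 R := \sum_(i < n) r i *: l1_delta i.

Let l1_truncE n r j : l1_trunc n r j = if (j < n)%N then r j else 0.
Proof.
rewrite /l1_trunc; elim: n => [|n IH]; first by rewrite big_ord0.
rewrite big_ord_recr/= -[LHS]/((\sum_(i < n) r i *: l1_delta i) j + r n * (j == n)%:R) IH.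
rewrite ltnS; case: (ltngtP j n) => [_|_|->]; first by rewrite mulr0 addr0.
  by rewrite mulr0 addr0.
by rewrite mulr1 add0r.
Qed.

Let l1_trunc_norm n r : `|r - l1_trunc n r| <= l1_norm r - [normed series r] n.
Proof.
rewrite lerBrDr; pose t : l1 R := r - l1_trunc n r; rewrite -/t.
have tE i : t i = if (i < n)%N then 0 else r i.
  by rewrite -[LHS]/(r i - l1_trunc n r i) l1_truncE; case: ifP; rewrite ?subrr ?subr0.
clearbody t.
suff H m : [normed series t] m + [normed series r] n <= l1_norm r.
  by rewrite -lerBrDr; apply: l1_norm_le => m; rewrite lerBrDr.
(* Among the first [n + m] terms of [r], the first [n] give the second summand; the others dominate
   the first [m] terms of [t], which vanishes below [n]. *)
apply: le_trans (l1_norm_ge r (n + m)); rewrite /= /series/=.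
rewrite [leRHS](@big_cat_nat _ _ _ n)//= ?leq_addr// [leRHS]addrC lerD2r.
apply: (@le_trans _ _ (\sum_(0 <= i < n + m) `|t i|)).
  by rewrite [leRHS](@big_cat_nat _ _ _ m)//= ?leq_addl// lerDl sumr_ge0.
rewrite (@big_cat_nat _ _ _ n)//= ?leq_addr// big_nat big1 ?add0r => [|i /andP[_ ni]].
  by rewrite ler_sum// => i _; rewrite tE; case: ifP; rewrite ?normr0.
by rewrite tE ni normr0.
Qed.

(** The representing sequence is [phi] on the unit sequences. Partial sums of its pairing with [r]
    are the values of [phi] at truncations of [r], which converge to [r] in norm. *)
Lemma l1_dual (phi : clin (l1 R) R) : exists x, forall r, phi r = pairing x r.
Proof.
have aP : (fun n => phi (l1_delta n)) \in @linf_pred R.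
  apply/linf_predP; exists `|phi| => n.
  by rewrite (le_trans (le_clin_norm _ _))// ler_piMr// l1_delta_norm.
exists (Linf aP) => r; apply/esym/cvg_lim => //; apply/cvgrPdist_lt => e e0.
(* Adding 1 covers the case of a zero functional. *)
have phi0 : 0 < `|phi| + 1 by rewrite ltr_pwDr.
have /cvgrPdist_lt/(_ (e / (`|phi| + 1)) (divr_gt0 e0 phi0)) := l1_cvg r.
apply: filterS => n rn.
have -> : series (fun i => Linf aP i * r i) n = phi (l1_trunc n r).
  rewrite /l1_trunc linear_sum/= /series/= big_mkord; apply: eq_bigr => i _.
  by rewrite linearZ/= mulrC.
rewrite -linearB (le_lt_trans (le_clin_norm _ _))//.
rewrite (@le_lt_trans _ _ ((`|phi| + 1) * `|r - l1_trunc n r|))//.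
  by rewrite ler_wpM2r// lerDl.
rewrite -ltr_pdivlMl// mulrC (le_lt_trans (l1_trunc_norm n r))//.
by rewrite (le_lt_trans _ rn)// ler_norm.
Qed.

Fact l1_mul1_subproof r : l1_mul^~ r \in @clin_pred R (linf R) (l1 R).
Proof.
apply: (@bounded_clin _ _ _ _ `|r|) => [a x y|x]; last by rewrite mulrC l1_mul_norm.
apply: l1_eqP => n.
rewrite -[LHS]/((a * x n + y n) * r n) -[RHS]/(a * (x n * r n) + y n * r n); ring.
Qed.
Definition l1_mul1 r : clin (linf R) (l1 R) := Clin (l1_mul1_subproof r).

End SequenceSpaces.

(** * Projections and injections of a product space *)

Section ProductMaps.
Context {R : realType} {V W : normedModType R}.

Fact clin_fst_subproof : fst \in @clin_pred R (V * W)%type V.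
Proof.
by apply: (@bounded_clin _ _ _ _ 1) => // -[a b]; rewrite mul1r prod_normE/= le_max lexx.
Qed.
Definition clin_fst : clin (V * W)%type V := Clin clin_fst_subproof.

Fact clin_snd_subproof : snd \in @clin_pred R (V * W)%type W.
Proof.
by apply: (@bounded_clin _ _ _ _ 1) => // -[a b]; rewrite mul1r prod_normE/= le_max lexx orbT.
Qed.
Definition clin_snd : clin (V * W)%type W := Clin clin_snd_subproof.

Fact clin_inl_subproof : (pair^~ 0) \in @clin_pred R V (V * W)%type.
Proof.
apply: (@bounded_clin _ _ _ _ 1) => [a u v|u].
  by congr pair; rewrite /= scaler0 addr0.
by rewrite mul1r prod_normE/= normr0 ge_max lexx/=.
Qed.
Definition clin_inl : clin V (V * W)%type := Clin clin_inl_subproof.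

Fact clin_inr_subproof : (pair 0) \in @clin_pred R W (V * W)%type.
Proof.
apply: (@bounded_clin _ _ _ _ 1) => [a u v|u].
  by congr pair; rewrite /= scaler0 addr0.
by rewrite mul1r prod_normE/= normr0 ge_max lexx/= andbT.
Qed.
Definition clin_inr : clin W (V * W)%type := Clin clin_inr_subproof.

End ProductMaps.

(** * Derivative of [Jmap], Hamiltonian vector fields and the two brackets *)

Section Poisson.
Context {R : realType}.
Local Open Scope seq_space_scope.
Variables (k : nat) (nu : l1 R).
Implicit Types (x v : linf R * l1 R) (rho eta : l1 R * l1 R) (a b : linf R * linf R).

Lemma tr_inj a b : tr^~ a =1 tr^~ b -> a = b.
Proof.
move=> ab; have := fun r => ab (r, 0); have := fun r => ab (0, r).
rewrite /tr/= => h2 h1; case: a b h1 h2 {ab} => [a1 a2] [b1 b2] /= h1 h2.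
congr pair; apply: pairing_inj_l => r.
  by have := h1 r; rewrite !pairing0r !addr0.
by have := h2 r; rewrite !pairing0r !add0r.
Qed.

Lemma omega_inj x v : omega x =1 omega v -> x = v.
Proof.
move=> xv; have := fun q => xv (q, 0); have := fun p => xv (0, p).
rewrite /omega/= => h2 h1; case: x v h1 h2 {xv} => [q p] [q' p'] /= h1 h2.
congr pair; [apply: pairing_inj_l => r | apply: pairing_inj_r => r].
  by have := h2 r; rewrite !pairing0l !subr0.
by have := h1 r; rewrite !pairing0r !sub0r => /oppr_inj.
Qed.

(** By [tr_inj] at most one element represents the differential, so [get] can only return [a]. *)
Lemma gradE (f : l1 R * l1 R -> R) rho a :
  (forall eta, 'd f rho eta = tr eta a) -> grad f rho = a.
Proof.
move=> fa; apply: get_unique => // b fb.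
by apply: tr_inj => eta; rewrite -fa -fb.
Qed.

Lemma ham_vfE (f : linf R * l1 R -> R) x v :
  (forall u, 'd f x u = omega v u) -> ham_vf f x = v.
Proof.
move=> fv; apply: get_unique => // u fu.
by apply: omega_inj => w; rewrite -fu -fv.
Qed.

(** Existence of the gradient: [l1_dual] represents the restriction of the differential to each of
    the two factors. *)
Lemma diff_grad (f : l1 R * l1 R -> R) rho eta : differentiable f rho ->
  'd f rho eta = tr eta (grad f rho).
Proof.
move=> df.
have dP : ('d f rho : _ -> R) \in @clin_pred R (l1 R * l1 R)%type R.
  apply/asboolP; split; last exact: diff_continuous.
  by move=> c u v; rewrite linearP.
have [a1 h1] := l1_dual (clin_comp (Clin dP) clin_inl).
have [a2 h2] := l1_dual (clin_comp (Clin dP) clin_inr).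
have da eta' : 'd f rho eta' = tr eta' (a1, a2).
  rewrite /tr/= -h1 -h2 /= -linearD; congr ('d f rho _).
  by case: eta' => r1 r2; congr pair; rewrite /= ?addr0 ?add0r.
by rewrite (gradE da).
Qed.

(* [s^(0)] is the identity. *)
Definition linf_diffL : clin (linf R) (linf R) := linf_shiftL k.-1 - linf_shiftL 0.

Definition dJmap x : clin (linf R * l1 R)%type (l1 R * l1 R)%type :=
  clin_comp clin_inl clin_snd + clin_comp clin_inr (clin_comp (l1_mul1 nu)
    (clin_comp (linf_mul1 (linf_exp (s^(k.-1) x.1 - x.1))) (clin_comp linf_diffL clin_fst))).

(** The exponential is the only nonlinear ingredient; isolating it between continuous linear maps
    reduces smoothness and the derivative to those of [linf_exp]. *)
Lemma JmapE : Jmap k nu = fun x => clin_comp clin_inl clin_snd x +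
  clin_comp clin_inr (l1_mul1 nu) ((linf_exp \o clin_comp linf_diffL clin_fst) x).
Proof.
by apply/funext => x; congr pair; rewrite /= ?addr0 ?add0r.
Qed.

Lemma dJmapE x v : dJmap x v = (v.2, (s^(k.-1) v.1 - v.1) *** (Jmap k nu x).2).
Proof.
congr pair; rewrite /= ?addr0 ?add0r//.
apply: l1_eqP => n /=.
set e := expR _; set d := _ n; rewrite -[LHS]/(e * d * nu n); ring.
Qed.

Lemma smooth_Jmap : smooth_on setT (Jmap k nu).
Proof.
move=> n; rewrite JmapE; apply: Cn_onD; first exact: Cn_on_clin.
apply: Cn_on_clin_comp; apply: (@Cn_on_comp _ _ _ _ _ _ setT) => //.
  exact: Cn_on_clin.
exact: Cn_on_linf_exp.
Qed.

Lemma is_diff_Jmap x : is_diff x (Jmap k nu) (dJmap x).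
Proof.
rewrite JmapE.
have h1 := is_diff_clin (clin_comp (@clin_inl R _ (l1 R)) (@clin_snd R (linf R) _)) x.
have h2 := is_diff_clin (clin_comp linf_diffL clin_fst) x.
have h3 := is_diff_linf_exp (clin_comp linf_diffL clin_fst x).
have h4 := is_diff_comp h2 h3.
have h5 := is_diff_clin (clin_comp (@clin_inr R (l1 R) _) (l1_mul1 nu))
  ((linf_exp \o clin_comp linf_diffL clin_fst) x).
exact: (is_diffD h1 (is_diff_comp h4 h5)).
Qed.

Let m := k.-1.

(** Transposing the shift leaves [v.1] paired with an element of l^1, which is what membership in
    [C_omega] demands. *)
Lemma tr_dJmap x v a : tr (dJmap x v) a =
  pairing a.1 v.2 + pairing v.1 (st^(m) (a.2 *** (Jmap k nu x).2) - a.2 *** (Jmap k nu x).2).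
Proof.
rewrite dJmapE /tr/=; congr (_ + _).
by rewrite -pairing_mul linf_mulC pairing_mul pairingBl pairingBr pairing_shift.
Qed.

Section Differential.
Variables (f : l1 R * l1 R -> R) (x : linf R * l1 R).
Hypothesis df : differentiable f (Jmap k nu x).

Let a := grad f (Jmap k nu x).
Let e := (Jmap k nu x).2.

Lemma diff_comp_Jmap v : 'd (f \o Jmap k nu) x v =
  pairing a.1 v.2 + pairing v.1 (st^(m) (a.2 *** e) - a.2 *** e).
Proof.
have dJ := is_diff_Jmap x.
by rewrite diff_comp//= diff_grad// -tr_dJmap (@diff_val _ _ _ _ _ _ _ dJ).
Qed.

Lemma ham_vf_comp_Jmap :
  ham_vf (f \o Jmap k nu) x = (a.1, a.2 *** e - st^(m) (a.2 *** e)).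
Proof.
(* In [omega X v] the component [X.2] is paired with [v.1] under a minus sign, hence the reversed
   difference. *)
by apply: ham_vfE => v; rewrite diff_comp_Jmap /omega/= !pairingBr opprB.
Qed.

End Differential.

Lemma omega_tr (a b : linf R * linf R) (rho : l1 R * l1 R) (e := rho.2) :
  omega (a.1, a.2 *** e - st^(m) (a.2 *** e)) (b.1, b.2 *** e - st^(m) (b.2 *** e)) =
  tr rho (lie_bracket k a b).
Proof.
rewrite {}/e; case: a b rho => [a1 a2] [b1 b2] [r1 e]; rewrite /omega /tr /lie_bracket /=.
(* Moving the shift back onto l^oo turns each side into the pairing of one bounded sequence with
   [e], and the sequences agree entrywise. The diagonal part of the Lie bracket is 0, so [r1] drops
   out. *)
have pE (x y : linf R) : pairing x (y *** e - st^(m) (y *** e)) = pairing ((x - s^(m) x) ** y) e.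
  by rewrite pairing_mul pairingBr -pairing_shift -pairingBl.
rewrite pairing0l add0r !pE -pairingBl -/m.
congr pairing; apply: linf_eqP => n.
set sa := s^(m) a1; set sb := s^(m) b1.
rewrite -[LHS]/((a1 n - sa n) * b2 n - (b1 n - sb n) * a2 n).
rewrite -[RHS]/(a2 n * (sb n - b1 n) - b2 n * (sa n - a1 n)); ring.
Qed.

Lemma bracket_Jmap (f g : l1 R * l1 R -> R) x :
  differentiable f (Jmap k nu x) -> differentiable g (Jmap k nu x) ->
  bracket_omega (f \o Jmap k nu) (g \o Jmap k nu) x = lie_poisson k f g (Jmap k nu x).
Proof.
by move=> df dg; rewrite /bracket_omega !ham_vf_comp_Jmap// omega_tr.
Qed.

Lemma smooth_differentiable (V W : normedModType R) (A : set V) (f : V -> W) u :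
  smooth_on A f -> A u -> differentiable f u.
Proof. by move=> /(_ 1%N)[fd _] /fd. Qed.

Lemma momentum_map_Jmap : momentum_map k (Jmap k nu).
Proof.
split; first exact: smooth_Jmap.
move=> A phi psi _ sphi spsi _ _ x Ax.
by apply: bracket_Jmap; [move: sphi|move: spsi] => /smooth_differentiable; exact.
Qed.

Lemma C_omega_Jmap (f : l1 R * l1 R -> R) :
  smooth_on setT f -> C_omega setT (f \o Jmap k nu).
Proof.
move=> sf; split=> [n|x _].
  by apply: (@Cn_on_comp _ _ _ _ _ _ setT) => //; exact: smooth_Jmap.
set e := (Jmap k nu x).2; set a := grad f (Jmap k nu x).
exists (st^(m) (a.2 *** e) - a.2 *** e) => v.
rewrite diff_comp_Jmap ?pairing0r ?add0r//.
exact: smooth_differentiable sf _.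
Qed.

End Poisson.

(** * Equivariance, orbits and the fibres of [Jmap] *)

Section Orbits.
Context {R : realType}.
Local Open Scope seq_space_scope.
Variables (k : nat) (nu : l1 R).
Implicit Types (q : linf R) (x y : linf R * l1 R) (rho : l1 R * l1 R).
Let m := k.-1.

(** Diagonal elements with prescribed logarithm; they supply all group elements constructed in the
    orbit arguments, including the identity as [gi_exp 0]. *)
Fact gi_exp_subproof q : exists2 c : R, 0 < c & forall n, c <= linf_exp q n.
Proof.
exists (expR (- `|q|)) => [|n]; first exact: expR_gt0.
have := le_linf_norm q n.
by rewrite ler_norml => /andP[? _]; rewrite /= ler_expR.
Qed.
Definition gi_exp q : GIinf R := GI 0 (gi_exp_subproof q).

Lemma gi_expK q : gi0_log (gi_exp q) = q.
Proof. by apply: linf_eqP => n; exact: expRK. Qed.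

Let E q : l1 R := linf_exp (s^(m) q - q) *** nu.

Let EE q n : E q n = expR (q (n + m)%N - q n) * nu n.
Proof. by rewrite -[LHS]/(expR ((s^(m) q) n - q n) * nu n) shiftE. Qed.

Lemma alphaE (g : GIinf R) (r : l1 R) n :
  alpha k g r n = gi0 g (n + m)%N / gi0 g n * r n.
Proof. by rewrite /= shiftE. Qed.

(** Exponentiating the difference of logarithms gives the quotient of entries of [gi0 g] by which
    [alpha] multiplies. This is equivariance in the second component. *)
Lemma alpha_exp (g : GIinf R) q : alpha k g (E q) = E (q + gi0_log g).
Proof.
have addE i : (q + gi0_log g) i = q i + ln (gi0 g i) by [].
apply: l1_eqP => n; rewrite alphaE !EE !addE opprD addrACA [in RHS]expRD.
rewrite [expR (ln _ - _)]expRB !lnK ?posrE ?gi0_gt0//; ring.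
Qed.

Lemma E0 : E 0 = nu.
Proof. by apply: l1_eqP => n; rewrite EE subrr expR0 mul1r. Qed.

(** Since [nu] is [E 0], [alpha_exp] matches group elements with their logarithms, and [gi_exp]
    shows that every [q] occurs. *)
Lemma DeltaE : Delta k nu = range E.
Proof.
rewrite eqEsubset; split=> [_ [g _ <-]|_ [q _ <-]].
  by exists (gi0_log g) => //; rewrite -[in RHS]E0 alpha_exp add0r.
by exists (gi_exp q) => //; rewrite -[in LHS]E0 alpha_exp add0r gi_expK.
Qed.

(** The second component of [coad] is [alpha] by definition. *)
Lemma delta_coad_orbit rho : delta @` coad_orbit k rho = Delta k rho.2.
Proof.
rewrite eqEsubset; split=> [_ [_ [g _ <-] <-]|_ [g _ <-]]; first by exists g.
by exists (coad k g rho) => //; exists g.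
Qed.

Lemma unshift0 n : st^(n) (0 : l1 R) = 0.
Proof. by apply: l1_eqP => i; rewrite unshiftE if_same. Qed.

Lemma coad_orbit_refl rho : coad_orbit k rho rho.
Proof.
exists (gi_exp 0) => //; case: rho => p r; rewrite /coad/=.
have -> : gi0_inv (gi_exp 0) ** 0 *** r = 0.
  by apply: l1_eqP => n; rewrite /= mulr0 mul0r.
rewrite unshift0 addr0 subr0; congr pair; apply: l1_eqP => n.
by rewrite /= shiftE /= expR0 divr1 mul1r.
Qed.

Lemma Delta_E q : Delta k (E q) = Delta k nu.
Proof.
rewrite DeltaE eqEsubset; split=> [_ [g _ <-]|_ [q' _ <-]].
  by exists (q + gi0_log g) => //; rewrite alpha_exp.
exists (gi_exp (q' - q)) => //.
by rewrite alpha_exp gi_expK addrC subrK.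
Qed.

Lemma range_Jmap : range (Jmap k nu) = delta @^-1` Delta k nu.
Proof.
rewrite DeltaE eqEsubset; split=> [_ [x _ <-]|[p r] [q _ qr]]; first by exists x.1.
by exists (q, p) => //; congr pair.
Qed.

(** The off-diagonal term vanishes, and the logarithm of [gi0 g] is [m]-periodic, so it cancels in
    the difference inside [E]. *)
Lemma Jmap_sigma_GL0 x y : sigma_GL0_orbit k nu x y -> Jmap k nu y = Jmap k nu x.
Proof.
move=> [g [gk0 sg] <-].
have lE n : ln (gi0 g (n + m)%N) = ln (gi0 g n) by rewrite -shiftE sg.
have a0 : (gik g ** gi0_inv g) *** (linf_exp (s^(m) x.1 - x.1) *** nu) = 0.
  by apply: l1_eqP => n; rewrite /= gk0 !mul0r.
congr pair; first by rewrite /= a0 unshift0 addr0 subr0.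
apply: l1_eqP => n; rewrite -[LHS]/(E (x.1 + gi0_log g) n) -[RHS]/(E x.1 n) !EE.
have addE i : (x.1 + gi0_log g) i = x.1 i + ln (gi0 g i) by [].
by rewrite !addE lE opprD addrACA subrr addr0.
Qed.

Hypothesis nu_neq0 : forall i, nu i != 0.

Lemma sigma_GL0_orbitE x : sigma_GL0_orbit k nu x = [set y | Jmap k nu y = Jmap k nu x].
Proof.
rewrite eqEsubset; split=> y; first exact: Jmap_sigma_GL0.
(* The candidate moves [x.1] to [y.1] and, being diagonal, fixes the momentum. It lies in [GL0]
   because cancelling [nu n] and the exponential makes [y.1 - x.1] periodic. *)
move=> [yx2 yxE]; exists (gi_exp (y.1 - x.1)).
  split => //; apply: linf_eqP => n; rewrite shiftE; congr expR.
  have : E y.1 n = E x.1 n by have /= := congr1 (@^~ n) yxE.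
  rewrite !EE => /(mulIf (nu_neq0 n))/expR_inj h.
  have subE i : (y.1 - x.1) i = y.1 i - x.1 i by [].
  by rewrite !subE; lra.
rewrite /sigma gi_expK; case: y yx2 {yxE} => q p /= ->.
rewrite addrC subrK; congr pair.
have -> : (0 ** gi0_inv (gi_exp (q - x.1))) *** (linf_exp (s^(m) x.1 - x.1) *** nu) = 0.
  by apply: l1_eqP => n; rewrite /= !mul0r.
by rewrite unshift0 addr0 subr0.
Qed.

End Orbits.

Theorem proposition6p2 (R : realType) (k : nat) (nu : l1 R) : (2 <= k)%N ->
  (* smooth, and constant on the orbits of the diagonal subgroup *)
  (smooth_on setT (Jmap k nu) /\
   forall x y, sigma_GL0_orbit k nu x y -> Jmap k nu y = Jmap k nu x) /\
  (* (i) *)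
  (momentum_map k (Jmap k nu) /\
   forall f g : l1 R * l1 R -> R, smooth_on setT f -> smooth_on setT g ->
     C_omega setT (f \o Jmap k nu) /\ C_omega setT (g \o Jmap k nu) /\
     bracket_omega (f \o Jmap k nu) (g \o Jmap k nu) =
       lie_poisson k f g \o Jmap k nu) /\
  (* (ii) *)
  (forall g : GIinf R, Jmap k nu \o sigma k nu g = coad k g \o Jmap k nu) /\
  (* (iii) *)
  (range (Jmap k nu) = delta @^-1` Delta k nu /\
   Jmap k nu @` (setT `*` [set 0]) = predual_incl @` Delta k nu /\
   ((forall i, nu i != 0) ->
     exists Jbar : set (linf R * l1 R) -> l1 R * l1 R,
       (forall x, Jbar (sigma_GL0_orbit k nu x) = Jmap k nu x) /\
       set_bij (range (sigma_GL0_orbit k nu)) (range (Jmap k nu)) Jbar) /\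
   range (Jmap k nu) =
     \bigcup_(O in [set O | range (coad_orbit k) O /\ delta @` O = Delta k nu]) O).
Proof.
move=> _; split; first by split; [exact: smooth_Jmap|exact: Jmap_sigma_GL0].
split.
  split=> [|f g sf sg]; first exact: momentum_map_Jmap.
  split; [exact: C_omega_Jmap|split; first exact: C_omega_Jmap].
  by apply/funext => x; apply: bracket_Jmap; exact: smooth_differentiable.
split.
  move=> g; apply/funext => x; congr pair.
    by rewrite /= linf_mulC.
  exact/esym/alpha_exp.
split; first exact: range_Jmap.
split.
  rewrite DeltaE eqEsubset; split=> [_ [[q p] [_ /= ->] <-]|_ [_ [q _ <-] <-]].
    by exists (Jmap k nu (q, 0)).2 => //; exists q.
  by exists (q, 0).
split.
  (* Evaluation at a chosen representative; on an orbit the choice is immaterial because [Jmap] is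
     constant there. *)
  move=> nu0; exists (fun O => Jmap k nu (get O)).
  have JbarE x : Jmap k nu (get (sigma_GL0_orbit k nu x)) = Jmap k nu x.
    apply: Jmap_sigma_GL0; apply: getPex; exists x.
    by rewrite sigma_GL0_orbitE.
  split => //; split.
  - by move=> _ [x _ <-]; rewrite /= JbarE; exists x.
  (* Injectivity: for generic [nu] an orbit is a whole fibre of [Jmap], so it is determined by its
     value. *)
  - move=> _ _ /set_mem[x _ <-] /set_mem[y _ <-]; rewrite !JbarE => xy.
    by rewrite !sigma_GL0_orbitE// xy.
  - by move=> _ [x _ <-]; exists (sigma_GL0_orbit k nu x).
rewrite eqEsubset; split=> [_ [x _ <-]|rho [_ [[rho0 _ <-] dO] Orho]].
  exists (coad_orbit k (Jmap k nu x)); last exact: coad_orbit_refl.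
  by split; [exists (Jmap k nu x)|rewrite delta_coad_orbit Delta_E].
(* The image is a full preimage under [delta], so it contains any orbit that projects onto
   [Delta k nu]. *)
by rewrite range_Jmap /= -dO; exists rho.
Qed.
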